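(* Let $C_{(<,\neq)}(x,y)$ be the bivariate generating function of the Catalan words avoiding the ordered pair of relations $(<,\neq)$, where $x$ marks the length and $y$ marks the number of descents. Then $$C_{(<,\neq)}(x,y)=\frac {1 - 2 x^2 - x^3 + 2 x^2 y-(1+x)\sqrt {1 - 2 x - x^2 + 2 x^3 + x^4 - 4 x^3 y}}{2x^{2}y}.$$
   Context: A Catalan word of length $n$ is a word $w=w_1w_2\cdots w_n$ over the non-negative integers with $w_1=0$ and $0\leq w_i\leq w_{i-1}+1$ for $i=2,\dots,n$; the empty word is the unique Catalan word of length $0$. For relations $X,Y\in\{<,>,\leq,\geq,=,\neq\}$, a word $w$ contains the pattern $(X,Y)$ if there is an index $i\geq 1$ (with $i+2\le n$) such that $w_i\,X\,w_{i+1}$ and $w_{i+1}\,Y\,w_{i+2}$; otherwise $w$ avoids $(X,Y)$. The number of descents $\mathrm{des}(w)$ is the number of indices $i$ with $w_i>w_{i+1}$. The bivariate generating function is $C_{(X,Y)}(x,y)=\sum_{w}x^{|w|}y^{\mathrm{des}(w)}$, the sum being over all Catalan words $w$ (of any length $|w|\geq 0$) avoiding $(X,Y)$. Identities are between formal power series in $x$ with coefficients polynomials in $y$ (after clearing denominators); the square root of a power series with constant term $1$ is the one with constant term $1$. *)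

(* Defs.v *)
From HB Require Import structures.
From mathcomp Require Import all_boot all_order all_algebra.
From mathcomp Require Import boolp.

Set Implicit Arguments.
Unset Strict Implicit.
Unset Printing Implicit Defensive.

Import GRing.Theory.
Local Open Scope ring_scope.

(* Words are sequences indexed from 0: the letter w_i of the literature is
   nth 0 w (i - 1). *)

Definition catalan (w : seq nat) : bool :=
  (head 0 w == 0)%N && sorted (fun a b => b <= a.+1)%N w.

Definition contains (X Y : rel nat) (w : seq nat) : bool :=
  [exists i : 'I_(size w),
    [&& (i.+2 < size w)%N, X (nth 0%N w i) (nth 0%N w i.+1)
      & Y (nth 0%N w i.+1) (nth 0%N w i.+2)]].

Definition avoids (X Y : rel nat) (w : seq nat) : bool := ~~ contains X Y w.

Definition des (w : seq nat) : nat :=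
  #|[set i : 'I_(size w).-1 | (nth 0 w i > nth 0 w i.+1)%N]|.

(* The letters of a Catalan word of length n are smaller than n, so that the
   Catalan words of length n are all among the n-tuples over 'I_n. *)
Lemma catalan_bound (w : seq nat) :
  catalan w -> all (fun a => a < size w)%N w.
Proof.
move=> /andP[/eqP w0 srt]; apply/(all_nthP 0%N) => i lt_i_w.
suff H : (nth 0 w i <= i)%N by exact: leq_ltn_trans H lt_i_w.
elim: i lt_i_w => [|i IHi] lt_i_w; first by rewrite nth0 w0.
case: w {w0} srt lt_i_w IHi => // a w /= /(pathP 0%N) srt lt_i_w IHi.
by apply: leq_trans (srt i lt_i_w) _; rewrite ltnS; apply: IHi; apply: ltnW.
Qed.

Record fps (R : Type) := Fps { fps_coef : nat -> R }.

Lemma fpsP (R : Type) (f g : fps R) :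
  (forall n, fps_coef f n = fps_coef g n) <-> f = g.
Proof. by case: f g => [f] [g]; split=> [/funext/= ->|->]. Qed.

HB.instance Definition _ (R : Type) := gen_eqMixin (fps R).
HB.instance Definition _ (R : Type) := gen_choiceMixin (fps R).

Section FpsRing.
Variable R : comNzRingType.
Implicit Types f g h : fps R.

Definition fps_zero : fps R := Fps (fun=> 0).
Definition fps_opp f : fps R := Fps (fun n => - fps_coef f n).
Definition fps_add f g : fps R := Fps (fun n => fps_coef f n + fps_coef g n).

Lemma fps_addA : associative fps_add.
Proof. by move=> f g h; apply/fpsP => n /=; rewrite addrA. Qed.
Lemma fps_addC : commutative fps_add.
Proof. by move=> f g; apply/fpsP => n /=; rewrite addrC. Qed.
Lemma fps_add0 : left_id fps_zero fps_add.
Proof. by move=> f; apply/fpsP => n /=; rewrite add0r. Qed.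
Lemma fps_addN : left_inverse fps_zero fps_opp fps_add.
Proof. by move=> f; apply/fpsP => n /=; rewrite addNr. Qed.

HB.instance Definition _ :=
  GRing.isZmodule.Build (fps R) fps_addA fps_addC fps_add0 fps_addN.

Definition fpsC (c : R) : fps R := Fps (fun n => if n == 0%N then c else 0).
Definition fps_mul f g : fps R :=
  Fps (fun n => \sum_(i < n.+1) fps_coef f i * fps_coef g (n - i)).

Lemma fps_mul_trunc f g N n : (n < N)%N ->
  fps_coef (fps_mul f g) n =
  (\poly_(i < N) fps_coef f i * \poly_(i < N) fps_coef g i)`_n.
Proof.
move=> lt_n_N; rewrite coefM; apply: eq_bigr => i _; rewrite !coef_poly.
rewrite (leq_ltn_trans _ lt_n_N) ?leq_ord //.
by rewrite (leq_ltn_trans (leq_subr _ _) lt_n_N).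
Qed.

Lemma fps_mulC : commutative fps_mul.
Proof.
by move=> f g; apply/fpsP => n; rewrite !(@fps_mul_trunc _ _ n.+1) // mulrC.
Qed.

Lemma fps_mulA : associative fps_mul.
Proof.
move=> f g h; apply/fpsP => n.
pose t (k : fps R) := \poly_(i < n.+1) fps_coef k i.
transitivity ((t f * (t g * t h))`_n).
  rewrite coefM; apply: eq_bigr => i _.
  rewrite coef_poly ltn_ord (@fps_mul_trunc _ _ n.+1) //.
  by rewrite ltnS leq_subr.
rewrite mulrA coefM; apply: eq_bigr => i _.
rewrite (@fps_mul_trunc _ _ n.+1) ?ltn_ord // coef_poly.
by rewrite ltnS leq_subr.
Qed.

Lemma fps_mul1 : left_id (fpsC 1) fps_mul.
Proof.
move=> f; apply/fpsP => n /=; rewrite big_ord_recl /= mul1r subn0.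
by rewrite big1 ?addr0 // => i _; rewrite mul0r.
Qed.

Lemma fps_mulDl : left_distributive fps_mul fps_add.
Proof.
move=> f g h; apply/fpsP => n /=; rewrite -big_split /=.
by apply: eq_bigr => i _; rewrite mulrDl.
Qed.

Lemma fps_one_neq0 : fpsC 1 != 0.
Proof.
by apply/eqP => /fpsP/(_ 0%N) /= /eqP; rewrite oner_eq0.
Qed.

HB.instance Definition _ := GRing.Zmodule_isComNzRing.Build (fps R)
  fps_mulA fps_mulC fps_mul1 fps_mulDl fps_one_neq0.

Definition fpsX : fps R := Fps (fun n => (n == 1%N)%:R).

Lemma fps_coef0 n : fps_coef (0 : fps R) n = 0. Proof. by []. Qed.
Lemma fps_coef1 n : fps_coef (1 : fps R) n = (n == 0%N)%:R.
Proof. by case: n. Qed.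
Lemma fps_coefN f n : fps_coef (- f) n = - fps_coef f n. Proof. by []. Qed.
Lemma fps_coefD f g n : fps_coef (f + g) n = fps_coef f n + fps_coef g n.
Proof. by []. Qed.
Lemma fps_coefM f g n :
  fps_coef (f * g) n = \sum_(i < n.+1) fps_coef f i * fps_coef g (n - i).
Proof. by []. Qed.

End FpsRing.

Arguments fpsX {R}.

Section FpsSqrt.
Variable R : comUnitRingType.
Implicit Types a s t : fps R.

(* The first n + 1 coefficients of the square root with constant term 1: the
   coefficient of degree n + 1 of s ^+ 2 = a reads
   2 s_{n+1} + \sum_{1 <= i <= n} s_i s_{n+1-i} = a_{n+1} when s_0 = 1. *)
Fixpoint fps_sqrt_seq a n : seq R :=
  if n is m.+1 then
    let s := fps_sqrt_seq a m in
    rcons s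
      ((fps_coef a n - \sum_(1 <= i < n) nth 0 s i * nth 0 s (n - i)) / 2)
  else [:: 1].

Definition fps_sqrt a : fps R := Fps (fun n => nth 0 (fps_sqrt_seq a n) n).

Lemma size_fps_sqrt_seq a n : size (fps_sqrt_seq a n) = n.+1.
Proof. by elim: n => //= n IHn; rewrite size_rcons IHn. Qed.

Lemma nth_fps_sqrt_seq a n i : (i <= n)%N ->
  nth 0 (fps_sqrt_seq a n) i = fps_coef (fps_sqrt a) i.
Proof.
elim: n => [|n IHn]; first by rewrite leqn0 => /eqP->.
rewrite leq_eqVlt => /predU1P[-> //|lt_i_n].
by rewrite /= nth_rcons size_fps_sqrt_seq lt_i_n; apply: IHn.
Qed.

Lemma fps_sqrt_rec a n : fps_coef (fps_sqrt a) n.+1 =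
  (fps_coef a n.+1 - \sum_(1 <= i < n.+1)
     fps_coef (fps_sqrt a) i * fps_coef (fps_sqrt a) (n.+1 - i)) / 2.
Proof.
rewrite /= nth_rcons size_fps_sqrt_seq ltnn eqxx; congr ((_ - _) / _).
rewrite !big_nat; apply: eq_bigr => i /andP[i_gt0 lt_i_n].
rewrite !nth_fps_sqrt_seq //.
by rewrite leq_subLR -add1n leq_add2r.
Qed.

Lemma fps_coef_sqr s n : fps_coef s 0 = 1 ->
  fps_coef (s ^+ 2) n.+1 = 2 * fps_coef s n.+1 +
    \sum_(1 <= i < n.+1) fps_coef s i * fps_coef s (n.+1 - i).
Proof.
move=> s0; rewrite expr2 fps_coefM.
rewrite -(big_mkord xpredT (fun i => fps_coef s i * fps_coef s (n.+1 - i))).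
rewrite big_nat_recr // big_ltn // subnn subn0 s0 mul1r mulr1 /=.
by rewrite mulr_natl mulr2n addrAC.
Qed.

Lemma fps_sqrt0 a : fps_coef (fps_sqrt a) 0 = 1.
Proof. by []. Qed.

Lemma fps_sqrtK a : (2 : R) \is a GRing.unit -> fps_coef a 0 = 1 ->
  fps_sqrt a ^+ 2 = a.
Proof.
move=> unit2 a0; apply/fpsP => -[|n].
  by rewrite expr2 fps_coefM big_ord1 /= mulr1 a0.
by rewrite fps_coef_sqr // fps_sqrt_rec mulrC divrK // subrK.
Qed.

Lemma fps_sqrt_unique a s : (2 : R) \is a GRing.unit ->
  fps_coef s 0 = 1 -> s ^+ 2 = a -> s = fps_sqrt a.
Proof.
move=> unit2 s0 sqr_s; apply/fpsP => n.
elim/ltn_ind: n => -[|n] IHn; first by rewrite s0 fps_sqrt0.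
rewrite fps_sqrt_rec -[X in fps_coef X n.+1 - _]sqr_s fps_coef_sqr //.
set S := \sum_(_ <= i < _) _; set T := \sum_(_ <= i < _) _.
suff -> : T = S by rewrite addrK mulrAC divrr // mul1r.
rewrite /S /T !big_nat; apply: eq_bigr => i /andP[i_gt0 lt_i_n].
have lt_ni : (n.+1 - i < n.+1)%N by rewrite ltn_subrL i_gt0.
by rewrite (IHn i) // (IHn (n.+1 - i)%N).
Qed.

End FpsSqrt.

Lemma unit2_poly_rat : (2 : {poly rat}) \is a GRing.unit.
Proof. by rewrite -polyC_natr poly_unitE size_polyC coefC. Qed.

(* The polynomial variable 'X of the coefficients marks the descents. *)
Definition catalan_gf (X Y : rel nat) : fps {poly rat} :=
  Fps (fun n =>
    \sum_(w : n.-tuple 'I_n | catalan (map val w) && avoids X Y (map val w))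
      'X ^+ des (map val w)).

(* Main.v *)
(* A nonempty word avoiding (<, <>) factors at its first return to 0 as
   0 (u + 1) v.  As the letter following an ascent has to be repeated, either u
   is empty, or u = 0 and v is empty, or u = 0 u' with u' nonempty admissible,
   and in the last case a nonempty v makes a descent and requires that u' not
   end with an ascent.  An admissible word ending with an ascent is a nonempty
   one which does not, extended by one letter.  If G counts the nonempty
   admissible words not ending with an ascent, this gives
     F = 1 + (1 + x) G   and   F = 1 + x F + x^2 F + x^2 y G (F - 1),
   and eliminating G leaves a quadratic equation for F. *)

Require Import Defs.
From mathcomp Require Import all_boot all_order all_algebra.
From mathcomp Require Import ring zify.

Set Implicit Arguments.
Unset Strict Implicit.
Unset Printing Implicit Defensive.

Import GRing.Theory.
Local Open Scope ring_scope.

(** * Recursive forms of the statistics and their behaviour at a junction *)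

Section Recursive.
Local Open Scope nat_scope.

(** The originals quantify over indices; structural recursion lets concatenations be analysed by
    induction. *)
Fixpoint desr (w : seq nat) : nat :=
  if w is a :: t then (if t is b :: _ then b < a else false) + desr t else 0.

Fixpoint avoidsr (w : seq nat) : bool :=
  if w is a :: t
  then (if t is b :: c :: _ then ~~ ((a < b) && (b != c)) else true)
       && avoidsr t
  else true.

Fixpoint ends_asc (w : seq nat) : bool :=
  if w is a :: t then (if t is [:: b] then a < b else ends_asc t) else false.

Lemma desE w : des w = desr w.
Proof.
rewrite /des -sum1dep_card big_mkcond /=.
elim: w => [|a [|b w] IHw] /=; rewrite ?big_ord0 //.
by rewrite big_ord_recl; congr (_ + _); apply: IHw.
Qed.

Lemma avoidsE w :
  avoids (fun a b => a < b) (fun a b => a != b) w = avoidsr w.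
Proof.
rewrite -[RHS]negbK /avoids /contains; congr (~~ _).
elim: w => [|a w IHw] /=.
  by apply/existsP => -[[]].
rewrite negb_and -IHw; apply/existsP/orP.
  move=> [[[|i] lt_i] /= /and3P[]].
    by case: w {IHw lt_i} => [|b [|c w]] //= _ -> ->; left.
  move=> h1 h2 h3; right; apply/existsP.
  by exists (Ordinal (lt_i : i < size w)) => /=; rewrite h2 h3 !andbT.
case=> [|/existsP[i /and3P[h1 h2 h3]]].
  by case: w {IHw} => [|b [|c w]] //=; rewrite negbK => h; exists ord0.
by exists (lift ord0 i); rewrite /= /bump /= add1n; apply/and3P.
Qed.

Lemma desr_mapS w : desr (map succn w) = desr w.
Proof. by elim: w => [|a [|b w] IHw] //; move: IHw => /= ->. Qed.

Lemma avoidsr_mapS w : avoidsr (map succn w) = avoidsr w.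
Proof. by elim: w => [|a [|b [|c w]] IHw] //; move: IHw => /= ->. Qed.

Lemma last_mapS_gt0 a u : 0 < last a.+1 (map succn u).
Proof. by elim: u a => //=. Qed.

Lemma ends_asc_mapS w : ends_asc (map succn w) = ends_asc w.
Proof. by elim: w => [|a [|b [|c w]] IHw]. Qed.

Lemma desr_cat a u b v : b < last a u ->
  desr (a :: u ++ b :: v) = desr (a :: u) + (desr (b :: v)).+1.
Proof.
elim: u a => [|c u IHu] a; first by move=> /= ->.
by move=> lt_b; rewrite [LHS]/= -!/(desr (c :: _)) -cat_cons IHu //= addnA.
Qed.

(** Two kinds of triples straddle the junction. One starting at the last letter of the left factor
    begins with a descent, hence is harmless; one ending at [b] is forbidden exactly when the left
    factor ends with an ascent. *)
Lemma avoidsr_cat a u b v : b < last a u ->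
  avoidsr (a :: u ++ b :: v) =
  [&& avoidsr (a :: u), ~~ ends_asc (a :: u) & avoidsr (b :: v)].
Proof.
elim: u a => [|c u IHu] a lt_b.
  by rewrite /=; case: v => //= d v; rewrite ltnNge ltnW.
have := IHu c lt_b; case: u lt_b {IHu} => [|d u] lt_b /= ->.
  by rewrite (gtn_eqF lt_b) /= andbT.
by rewrite !andbA.
Qed.

Lemma desr_rcons a u b : last a u <= b -> desr (a :: rcons u b) = desr (a :: u).
Proof.
elim: u a => [|c u IHu] a le_b ; first by rewrite /= ltnNge le_b.
by have /= -> := IHu c le_b.
Qed.

Lemma ends_asc_rcons a u b : ends_asc (a :: rcons u b) = (last a u < b).
Proof. by elim: u a => [|c [|d u] IHu] a //; apply: (IHu c). Qed.

(** The only new triple ends with two distinct letters, so it is forbidden exactly when it starts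
    with an ascent. *)
Lemma avoidsr_rcons a u b : last a u < b ->
  avoidsr (a :: rcons u b) = avoidsr (a :: u) && ~~ ends_asc (a :: u).
Proof.
elim: u a => [|c u IHu] a lt_b //.
have := IHu c lt_b; case: u lt_b {IHu} => [|d u] lt_b.
  by move=> _ /=; rewrite (ltn_eqF lt_b) !andbT.
by move=> /= ->; rewrite !andbA.
Qed.

Lemma catalan_rcons a u : catalan (a :: rcons u (last a u).+1) = catalan (a :: u).
Proof. by rewrite /catalan /= rcons_path leqnn andbT. Qed.

(** The letter after the initial 0 is at most 1, which forces [u] to start with 0, while a 0 may
    follow any letter. The default of [head] lets [v] be empty. *)
Lemma catalan_first_return u v :
  catalan (0 :: map succn u ++ v) && (head 0 v == 0) = catalan u && catalan v.
Proof.
rewrite /catalan /= cat_path.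
have -> : path (fun a b => b <= a.+1) 0 (map succn u) = catalan u.
  case: u => [|a u] //; rewrite /catalan /= ltnS leqn0; congr (_ && _).
  by rewrite path_map; apply: eq_path.
by rewrite -andbA; congr (_ && _); case: v => //= -[|b] v; rewrite ?andbF ?andbT.
Qed.

Definition admissible (w : seq nat) := catalan w && avoidsr w.

Lemma admissible_cons0 v : admissible (0 :: v) && (head 0 v == 0) = admissible v.
Proof.
have := catalan_first_return [::] v; rewrite /= /admissible andbAC => ->.
by case: v => [|[|b] [|c v]] //=.
Qed.

Lemma admissible_lone_peak v :
  admissible [:: 0, 1 & v] && (head 0 v == 0) = nilp v.
Proof.
have := catalan_first_return [:: 0] v; rewrite /= /admissible andbAC => ->.
by case: v => //= -[|c] v; rewrite /= ?andbF.
Qed.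

Lemma admissible_first_return u v : 0 < size u ->
  admissible ([:: 0, 1 & map succn u] ++ v) && (head 0 v == 0)
  = [&& admissible u, admissible v & nilp v || ~~ ends_asc u].
Proof.
case: u => // a u _.
have := catalan_first_return (0 :: a :: u) v; rewrite /= /admissible andbAC => ->.
have cat0 : catalan (0 :: a :: u) && (a == 0) = catalan (a :: u).
  by have := catalan_first_return [::] (a :: u).
case: (altP (a =P 0)) cat0 => [-> | a0].
  rewrite andbT => ->.
  have av011 t : avoidsr [:: 0, 1, 1 & t] = avoidsr (1 :: t) by case: t.
  have avu : avoidsr (1 :: map succn u) = avoidsr (0 :: u).
    by rewrite -(avoidsr_mapS (0 :: u)).
  have eau : ends_asc (1 :: map succn u) = ends_asc (0 :: u).
    by rewrite -(ends_asc_mapS (0 :: u)).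
  rewrite av011; case: v => [|b v].
    by rewrite cats0 avu /= !andbT.
  case: (altP (b =P 0)) => [->|b0]; last first.
    by rewrite /catalan /= (negPf b0) /= !andbF.
  rewrite avoidsr_cat ?last_mapS_gt0 // avu eau.
  by rewrite orFb -!andbA; do !bool_congr.
(* Here the ascent from 0 to 1 is followed by [a.+1], which differs from 1. *)
have -> : catalan (a :: u) = false by rewrite /catalan /= (negPf a0).
by move=> _; rewrite /= eqSS (eq_sym 0) (negPf a0) !andbF.
Qed.

End Recursive.

(** * Lists of admissible words and their descent polynomials *)

Definition words n : seq (seq nat) :=
  [seq map val (tval t) | t <- index_enum {: n.-tuple 'I_n}
                        & admissible (map val (tval t))].

Lemma words_uniq n : uniq (words n).
Proof.
rewrite map_inj_uniq ?filter_uniq ?index_enum_uniq //.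
by move=> s t /(inj_map val_inj) /val_inj.
Qed.

Lemma mem_words n w : (w \in words n) = (size w == n) && admissible w.
Proof.
apply/mapP/andP => [[t]|[/eqP sz_w good_w]].
  by rewrite mem_filter => /andP[good_t _] ->; rewrite size_map size_tuple eqxx.
have /andP[cat_w _] := good_w; have := catalan_bound cat_w; rewrite sz_w => lt_w.
(* By [catalan_bound] every letter is below [n], so [insub] discards none. *)
have sz_t : size (pmap (insub : nat -> option 'I_n) w) == n.
  rewrite size_pmap_sub (eqP (_ : count _ w == n)) //.
  by rewrite -[X in _ == X]sz_w -all_count.
have wE : w = map val (pmap (insub : nat -> option 'I_n) w).
  rewrite (pmap_filter (insubK _)); apply/esym/all_filterP.
  by apply: sub_all lt_w => a; rewrite isSome_insub.
by exists (Tuple sz_t) => //; rewrite mem_filter -wE good_w mem_index_enum.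
Qed.

(** Carries the bijections below: each is given as an explicit duplicate-free list of the words
    concerned. *)
Lemma sum_words n (P : pred (seq nat)) (L : seq (seq nat))
    (F : seq nat -> {poly rat}) :
    uniq L -> (forall w, (w \in L) = [&& size w == n, admissible w & P w]) ->
  \sum_(w <- words n | P w) F w = \sum_(w <- L) F w.
Proof.
move=> uniqL memL; rewrite -big_filter; apply: perm_big.
apply: uniq_perm => // [|w]; first exact/filter_uniq/words_uniq.
by rewrite mem_filter mem_words memL andbC -andbA.
Qed.

Definition words_gf n : {poly rat} := \sum_(w <- words n) 'X ^+ desr w.

(** Coefficients of the series G. The empty word does not end with an ascent, so it has to be
    excluded separately. *)
Definition flat_words_gf n : {poly rat} :=
  if n is 0 then 0 else \sum_(w <- words n | ~~ ends_asc w) 'X ^+ desr w.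

Lemma catalan_gfE n :
  fps_coef (catalan_gf (fun a b => a < b)%N (fun a b => a != b)) n = words_gf n.
Proof.
rewrite /words_gf big_map big_filter /=; apply: eq_big => [t|t _].
  by rewrite avoidsE.
by rewrite desE.
Qed.

Lemma words_gf0 : words_gf 0 = 1.
Proof.
rewrite /words_gf (@sum_words 0 xpredT [:: [::]]) // ?big_seq1 //.
by move=> [|a w].
Qed.

(** Deleting the top of a final ascent loses no information and no descent: the Catalan condition
    makes that top the previous letter plus one. *)
Lemma words_gfS_last n : words_gf n.+1 = flat_words_gf n.+1 + flat_words_gf n.
Proof.
rewrite /words_gf (bigID ends_asc) /= addrC; congr (_ + _).
case: n => [|n].
  (* A one-letter word has no ascent, in agreement with [flat_words_gf 0 = 0]. *)
  by rewrite big_seq_cond big1 // => -[|a [|b w]]; rewrite mem_words // andbF.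
pose ext (w : seq nat) := rcons w (last 0%N w).+1.
rewrite (@sum_words _ _ (map ext [seq w <- words n.+1 | ~~ ends_asc w])).
- rewrite big_map big_filter big_seq_cond [RHS]big_seq_cond.
  apply: eq_bigr => -[|a w].
    by rewrite mem_words.
  by move=> _; rewrite /ext rcons_cons desr_rcons.
- rewrite map_inj_in_uniq ?filter_uniq ?words_uniq //.
  by move=> u v _ _ /rcons_inj[].
move=> w; apply/mapP/and3P => [[u]|[]].
  rewrite mem_filter mem_words => /and3P[eau /eqP sz_u /andP[cu au]] ->.
  case: u sz_u eau cu au => // a u sz_u eau cu au.
  rewrite /admissible /ext rcons_cons catalan_rcons ends_asc_rcons avoidsr_rcons //.
  by rewrite leqnn cu au eau -sz_u /= size_rcons eqxx.
case/lastP: w => // -[|a u] b //.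
rewrite rcons_cons ends_asc_rcons /= size_rcons !eqSS => sz_u /andP[+ +] lt_b.
rewrite avoidsr_rcons // => cu /andP[au eau].
have bE : b = (last a u).+1.
  apply/eqP; rewrite eqn_leq lt_b andbT.
  by move: cu; rewrite /catalan /= rcons_path => /and3P[].
move: cu; rewrite bE catalan_rcons => cu.
by exists (a :: u) => //; rewrite mem_filter eau mem_words /= eqSS sz_u /admissible cu.
Qed.

(** * Decomposition at the first return to 0 *)

Definition first_return (w : seq nat) := find (pred1 0%N) (behead w).

Definition join (p : seq nat * seq nat) := 0%N :: map succn p.1 ++ p.2.

(** Shifted letters are positive, so the search for 0 skips exactly [u]. If [v] is empty, the search
    fails and [find] returns the length of the tail, again the size of [u]. *)
Lemma first_return_join u v : head 0%N v = 0%N ->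
  first_return (join (u, v)) = size u.
Proof.
move=> v0; rewrite /first_return /= find_cat has_map.
rewrite (eq_has (a2 := pred0)) // has_pred0 size_map.
by case: v v0 => [|b v] /= => [_|->]; rewrite addn0.
Qed.

Lemma catalan_joinP w : catalan w -> (0 < size w)%N ->
  exists u v, w = join (u, v) /\ head 0%N v = 0%N.
Proof.
case: w => // a t /andP[/eqP /= -> _] _.
exists (map predn (take (find (pred1 0%N) t) t)), (drop (find (pred1 0%N) t) t).
split; last first.
  by elim: t => //= -[|b] t.
rewrite /join /=; congr (_ :: _).
by elim: t => //= -[|b] t //= {1}->.
Qed.

Lemma sum_first_return n k Lp (F : seq nat -> {poly rat}) :
    uniq Lp ->
    (forall u v, ((u, v) \in Lp) =
       [&& size u == k, size u + size v == n, admissible (join (u, v))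
         & head 0 v == 0]%N) ->
  \sum_(w <- words n.+1 | first_return w == k) F w = \sum_(p <- Lp) F (join p).
Proof.
move=> uniqL memL; rewrite -(big_map join xpredT); apply: sum_words.
  (* Fixing the size of the first component makes [join] injective. *)
  rewrite map_inj_in_uniq // => -[u v] [u' v'].
  rewrite !memL => /and4P[/eqP sz_u _ _ _] /and4P[/eqP sz_u' _ _ _] [] /eqP.
  rewrite eqseq_cat ?size_map ?sz_u //.
  by case/andP=> /eqP /(inj_map succn_inj) -> /eqP ->.
move=> w; apply/mapP/and3P => [[[u v]]|[sz_w good_w]].
  rewrite memL => /and4P[sz_u sz_w good_w /eqP v0] ->.
  by rewrite first_return_join // /join /= size_cat size_map eqSS.
have /andP[cat_w _] := good_w.
have [|u [v [wE v0]]] := catalan_joinP cat_w; first by rewrite (eqP sz_w).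
rewrite wE first_return_join // => sz_u.
move: sz_w good_w; rewrite wE /= size_cat size_map eqSS => sz_w good_w.
by exists (u, v); rewrite // memL sz_u sz_w good_w v0.
Qed.

Lemma sum_words_first_return n (F : seq nat -> {poly rat}) :
  \sum_(w <- words n.+1) F w =
  \sum_(k < n.+1) \sum_(w <- words n.+1 | first_return w == k) F w.
Proof.
under [RHS]eq_bigr => k _ do rewrite big_mkcond.
rewrite exchange_big /=; rewrite !big_seq; apply: eq_bigr => w.
rewrite mem_words => /andP[/eqP sz_w _].
have lt_k : (first_return w < n.+1)%N.
  by rewrite ltnS (leq_trans (find_size _ _)) // size_behead sz_w.
by rewrite -big_mkcond (big_pred1 (Ordinal lt_k)).
Qed.

Lemma admissible_join_head u v :
  admissible (join (u, v)) && (head 0%N v == 0%N) -> (0 < size u)%N -> head 1%N u = 0%N.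
Proof.
rewrite /admissible andbAC catalan_first_return.
case/andP=> /andP[/andP[/eqP u0 _] _] _.
by case: u u0.
Qed.

Lemma sum_return0 n :
  \sum_(w <- words n.+1 | first_return w == 0%N) 'X ^+ desr w = words_gf n.
Proof.
rewrite (@sum_first_return n 0 [seq ([::], v) | v <- words n]).
- rewrite big_map /words_gf !big_seq; apply: eq_bigr => v.
  by rewrite mem_words => /andP[_ /andP[/andP[]]]; case: v => //= -[].
- by rewrite map_inj_uniq ?words_uniq // => u v [].
move=> [|a u] v; last first.
  by rewrite [RHS]/=; apply/mapP => -[].
by rewrite admissible_cons0 -mem_words mem_map // => u u' [].
Qed.

(** The single letter of [u] must be 0, and its peak cannot be followed by a 0; only the word 01
    remains. *)
Lemma sum_return1 n :
  \sum_(w <- words n.+1 | first_return w == 1%N) 'X ^+ desr w =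
  (n == 1%N)%:R :> {poly rat}.
Proof.
rewrite (@sum_first_return n 1 (if n == 1%N then [:: ([:: 0%N], [::])] else [::])).
- by case: eqP; rewrite ?big_seq1 ?big_nil.
- by case: eqP.
move=> u v.
have [/eqP|sz_u] := boolP (size u == 1%N); last first.
  by apply: contraNF sz_u; case: eqP => // _; rewrite inE => /eqP[-> _].
case: u => // a [] // _ /=.
have [a0|a0] := eqVneq a 0%N; last first.
  rewrite (_ : _ \in _ = false); last first.
    by case: eqP => // _; rewrite inE; apply/eqP => -[/eqP]; rewrite (negPf a0).
  apply/esym/negP => /andP[_ /admissible_join_head] /(_ isT) /= /eqP; exact/negP.
rewrite a0 admissible_lone_peak; case: v => [|b v].
  by rewrite addn0 eq_sym; case: eqP.
by rewrite andbF; case: eqP.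
Qed.

Lemma admissible_head a u : admissible (a :: u) -> a = 0%N.
Proof. by case/andP=> /andP[/eqP]. Qed.

Lemma desr_join u v : admissible u -> admissible v -> (0 < size u)%N ->
  desr (join (0%N :: u, v)) = (desr u + if nilp v then 0 else (desr v).+1)%N.
Proof.
case: u => // a u /admissible_head -> good_v _.
have desr011 t : desr [:: 0, 1, 1 & t]%N = desr (1%N :: t) by [].
have desu : desr (1%N :: map succn u) = desr (0%N :: u).
  by rewrite -(desr_mapS (0%N :: u)).
rewrite -[join _]/([:: 0, 1, 1 & map succn u ++ v]%N) desr011.
case: v good_v => [|b v] good_v; first by rewrite cats0 desu addn0.
by rewrite desr_cat ?desu // (admissible_head good_v) last_mapS_gt0.
Qed.

(** In [u], a leading 0 precedes an admissible word of length [j.+1], and [m] is the length of [v].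
    The factor ['X] is the descent into a nonempty [v]. *)
Lemma sum_return_ge2 j m :
  \sum_(w <- words (j.+2 + m).+1 | first_return w == j.+2) 'X ^+ desr w =
  if m == 0%N then words_gf j.+1 else 'X * (flat_words_gf j.+1 * words_gf m).
Proof.
rewrite (@sum_first_return _ _
  [seq (0%N :: u, v) | u <- [seq u <- words j.+1 | (m == 0%N) || ~~ ends_asc u],
                       v <- words m]).
- rewrite big_allpairs_dep big_filter.
  transitivity (\sum_(u <- words j.+1 | (m == 0%N) || ~~ ends_asc u)
    \sum_(v <- words m) (if m == 0%N then 'X ^+ desr u
                         else 'X * ('X ^+ desr u * 'X ^+ desr v)) : {poly rat}).
    rewrite big_seq_cond [RHS]big_seq_cond; apply: eq_bigr => u.
    rewrite mem_words => /andP[/andP[/eqP sz_u good_u] _].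
    rewrite !big_seq; apply: eq_bigr => v.
    rewrite mem_words => /andP[/eqP sz_v good_v].
    rewrite desr_join ?sz_u // /nilp sz_v.
    case: (m == 0%N); first by rewrite addn0.
    by rewrite addnS exprS exprD.
  case: m => [|m] /=.
    apply: eq_bigr => u _; rewrite (@sum_words 0 xpredT [:: [::]]) ?big_seq1 //.
    by case.
  rewrite big_distrlr big_distrr /=; apply: eq_bigr => u _.
  by rewrite big_distrr.
- rewrite allpairs_uniq ?filter_uniq ?words_uniq //.
  by move=> [u v] [u' v'] _ _ [-> ->].
move=> u v; have [/eqP|sz_u] := boolP (size u == j.+2); last first.
  apply: contraNF sz_u => /allpairsP[[u' v']] /= [].
  by rewrite mem_filter mem_words => /and3P[_ /eqP + _] _ [-> _] /= => ->.
case: u => // a u [sz_u].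
have [->|a0] := eqVneq a 0%N; last first.
  transitivity false.
    by apply/allpairsP => -[[u' v']] [_ _ [/eqP]]; rewrite (negPf a0).
  apply/esym/negP => /and3P[_ _ /admissible_join_head] /(_ isT) /eqP.
  by rewrite /= (negPf a0).
have -> : admissible (join (0%N :: u, v)) && (head 0%N v == 0%N)
    = [&& admissible u, admissible v & nilp v || ~~ ends_asc u].
  by rewrite -admissible_first_return ?sz_u.
rewrite /= sz_u eqn_add2l.
apply/allpairsP/idP => [[[u' v']] /= []|].
  rewrite mem_filter !mem_words.
  move=> /and3P[eau sz_u' good_u'] /andP[sz_v' good_v'] [-> ->].
  by rewrite sz_v' good_u' good_v' /nilp (eqP sz_v') eau.
move=> /and4P[sz_v good_u good_v eau]; exists (u, v) => /=.
by rewrite mem_filter !mem_words sz_u eqxx good_u sz_v good_v -(eqP sz_v) eau.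
Qed.

(** The conditional is the coefficient of F - 1. The term [words_gf n] collects the words that never
    return to 0, by deletion of their prefix 01 and lowering of the rest. *)
Lemma words_gf_rec n :
  words_gf n.+2 = words_gf n.+1 + words_gf n +
    'X * \sum_(i < n.+1) flat_words_gf i *
           (if (n - i == 0)%N then 0 else words_gf (n - i)).
Proof.
rewrite [LHS]sum_words_first_return big_ord_recl big_ord_recl.
rewrite sum_return0 sum_return1 -addrA; congr (_ + _).
rewrite /lift /= /bump /=.
have return_ge2 (k : 'I_n) :
    \sum_(w <- words n.+2 | first_return w == (1 + (1 + k))%N) 'X ^+ desr w =
    if (n - k.+1 == 0)%N then words_gf k.+1
    else 'X * (flat_words_gf k.+1 * words_gf (n - k.+1)).
  rewrite -sum_return_ge2 (_ : (k.+2 + (n - k.+1)).+1 = n.+2)%N //.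
  by have := ltn_ord k; lia.
rewrite (eq_bigr _ (fun k _ => return_ge2 k)) {return_ge2}.
rewrite [X in 'X * X]big_ord_recl mul0r add0r.
(* For length 2 the non-returning word is 01; for greater lengths the non-returning words are the
   last summand, where [v] is empty. *)
case: n => [|n]; first by rewrite !big_ord0 words_gf0 mulr0.
rewrite eqSS eqE /= add0r big_ord_recr [X in _ = _ + _ * X]big_ord_recr /=.
rewrite subnn eqxx mulr0 addr0 addrC; congr (_ + _).
rewrite big_distrr; apply: eq_bigr => i _.
by rewrite /= /bump /= add1n subn_eq0 leqNgt ltnS ltn_ord.
Qed.

(** * Functional equations and solution of the quadratic *)

Lemma fps_coefXM (R : comNzRingType) (f : fps R) n :
  fps_coef (fpsX * f) n = if n is m.+1 then fps_coef f m else 0.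
Proof.
rewrite fps_coefM; case: n => [|n]; first by rewrite big_ord1 mul0r.
rewrite !big_ord_recl big1 => [|i _]; last by rewrite mul0r.
by rewrite addr0 mul0r add0r mul1r subSS subn0.
Qed.

Lemma fps_coefCM (R : comNzRingType) c (f : fps R) n :
  fps_coef (fpsC c * f) n = c * fps_coef f n.
Proof.
by rewrite fps_coefM big_ord_recl big1 ?addr0 ?subn0 // => i _; rewrite mul0r.
Qed.

Lemma words_gf1 : words_gf 1 = 1.
Proof. by rewrite [LHS]sum_words_first_return big_ord1 sum_return0 words_gf0. Qed.

Lemma quadratic_of_system (R : comNzRingType) (x y F G : R) :
    F = 1 + (1 + x) * G ->
    F = 1 + x * F + x * (x * F) + x * (x * (y * (G * (F - 1)))) ->
  F = 1 + x + 2 * x ^+ 2 * F + x ^+ 3 * F + x ^+ 2 * y * (F - 1) ^+ 2.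
Proof.
move=> /eqP; rewrite -subr_eq0 => /eqP flatE /eqP; rewrite -subr_eq0 => /eqP returnE.
apply/eqP; rewrite -subr_eq0; apply/eqP.
transitivity ((1 + x) *
    (F - (1 + x * F + x * (x * F) + x * (x * (y * (G * (F - 1))))))
  - x ^+ 2 * y * (F - 1) * (F - (1 + (1 + x) * G))); first by ring.
by rewrite flatE returnE !mulr0 subr0.
Qed.

(** Completing the square after multiplication by 4 x^2 y; the discriminant has the square factor (1
    + x)^2. *)
Lemma discriminant_of_quadratic (R : comNzRingType) (x y F : R) :
    F = 1 + x + 2 * x ^+ 2 * F + x ^+ 3 * F + x ^+ 2 * y * (F - 1) ^+ 2 ->
  (1 - 2 * x ^+ 2 - x ^+ 3 + 2 * x ^+ 2 * y - 2 * x ^+ 2 * y * F) ^+ 2 =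
  (1 + x) ^+ 2 * (1 - 2 * x - x ^+ 2 + 2 * x ^+ 3 + x ^+ 4 - 4 * x ^+ 3 * y).
Proof.
move=> /eqP; rewrite -subr_eq0 => /eqP quadratic.
apply/eqP; rewrite -subr_eq0; apply/eqP.
transitivity (- (4 * x ^+ 2 * y) *
  (F - (1 + x + 2 * x ^+ 2 * F + x ^+ 3 * F + x ^+ 2 * y * (F - 1) ^+ 2))).
  by ring.
by rewrite quadratic mulr0.
Qed.

Theorem theorem3p36 :
  let x : fps {poly rat} := fpsX in
  let y : fps {poly rat} := fpsC 'X in
  2 * x ^+ 2 * y * catalan_gf (fun a b => a < b)%N (fun a b => a != b) =
  1 - 2 * x ^+ 2 - x ^+ 3 + 2 * x ^+ 2 * y
  - (1 + x) * fps_sqrt (1 - 2 * x - x ^+ 2 + 2 * x ^+ 3 + x ^+ 4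
                        - 4 * x ^+ 3 * y).
Proof.
move=> x y; set F := catalan_gf _ _; set D := (X in fps_sqrt X).
pose G := Fps flat_words_gf.
have flatE : F = 1 + (1 + x) * G.
  apply/fpsP => n; rewrite mulrDl mul1r !fps_coefD fps_coef1 fps_coefXM catalan_gfE.
  by case: n => [|n]; rewrite ?words_gf0 ?words_gfS_last /= ?addr0 ?add0r.
have first_returnE : F = 1 + x * F + x * (x * F) + x * (x * (y * (G * (F - 1)))).
  apply/fpsP => n; rewrite !fps_coefD fps_coef1.
  case: n => [|[|n]]; rewrite !fps_coefXM ?fps_coefXM !catalan_gfE.
  - by rewrite words_gf0 !addr0.
  - by rewrite words_gf1 words_gf0 !addr0 add0r.
  rewrite fps_coefCM words_gf_rec add0r; congr (_ + _ * _).
  rewrite fps_coefM; apply: eq_bigr => i _; congr (_ * _).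
  rewrite fps_coefD fps_coefN fps_coef1 catalan_gfE.
  by case: eqP => [->|_]; rewrite ?words_gf0 ?subrr ?subr0.
have sqrQ := discriminant_of_quadratic (quadratic_of_system flatE first_returnE).
(* Taking constant terms is a ring morphism, so they can be computed by rewriting. *)
pose c0 (f : fps {poly rat}) := fps_coef f 0.
have c0M f g : c0 (f * g) = c0 f * c0 g by rewrite /c0 fps_coefM big_ord1.
have c0D f g : c0 (f + g) = c0 f + c0 g by [].
have c0N f : c0 (- f) = - c0 f by [].
have c0x : c0 x = 0 by [].
have c01 : c0 1 = 1 by [].
have D0 : c0 D = 1.
  by rewrite /D !exprS !(c0M, c0D, c0N, c0x, c01, mul0r, mulr0, oppr0, addr0).
have sqrD := fps_sqrtK unit2_poly_rat D0.
set S := fps_sqrt D in sqrD *.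
pose Q := 1 - 2 * x ^+ 2 - x ^+ 3 + 2 * x ^+ 2 * y - 2 * x ^+ 2 * y * F.
have Q0 : c0 Q = 1.
  by rewrite /Q !exprS !(c0M, c0D, c0N, c0x, c01, mul0r, mulr0, oppr0, addr0).
have S0 : c0 ((1 + x) * S) = 1 by rewrite c0M c0D c0x c01 addr0 mul1r.
have {}sqrQ : Q ^+ 2 = ((1 + x) * S) ^+ 2 by rewrite exprMn sqrD.
(* Both sides have constant term 1 and the same square; this fixes the sign of the root. *)
have QE : Q = (1 + x) * S.
  rewrite (fps_sqrt_unique unit2_poly_rat Q0 sqrQ).
  exact/esym/(fps_sqrt_unique unit2_poly_rat S0).
by rewrite -QE /Q; ring.
Qed.
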